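(* Let $0<\rho<\sigma<1$, let $G_1,\dots,G_m:\mathbb{R}^n\to\mathcal{I}(\mathbb{R})$ be $gH$-continuously differentiable interval-valued maps, let $x\in\mathbb{R}^n$, and let $d\in\mathbb{R}^n$ be a descent direction for all $G_i$ at $x$, i.e. $\psi\circ\phi_x(d)<0$. Suppose that for each $i=1,\dots,m$ there exists $A_i\in\mathcal{I}(\mathbb{R})$ such that $G_i(x+td)\succeq A_i$ for all $t>0$. Then there exists an interval of step lengths $(a,b)$ with $0\le a<b$ such that every $t\in(a,b)$ satisfies both the standard Wolfe conditions $$G_i(x+td)\preceq G_i(x)\oplus[\rho t,\rho t]\odot \psi\circ\phi_x(d)\ \ (i=1,\dots,m),\qquad \psi\circ\phi_{x+td}(d)\ge\sigma\,\psi\circ\phi_x(d),$$ and the strong Wolfe conditions $$G_i(x+td)\preceq G_i(x)\oplus[\rho t,\rho t]\odot \psi\circ\phi_x(d)\ \ (i=1,\dots,m),\qquad |\psi\circ\phi_{x+td}(d)|\le\sigma\,|\psi\circ\phi_x(d)|.$$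
   Context: $\mathcal{I}(\mathbb{R})$ is the set of closed bounded intervals of $\mathbb{R}$. For $A=[a_1,a_2]$, $B=[b_1,b_2]$ in $\mathcal{I}(\mathbb{R})$ and $\alpha\in\mathbb{R}$: $A\oplus B=[a_1+b_1,a_2+b_2]$; $\alpha\odot A=A\odot\alpha=[\min\{\alpha a_1,\alpha a_2\},\max\{\alpha a_1,\alpha a_2\}]$; $A\preceq B$ (equivalently $B\succeq A$) means $a_1\le b_1$ and $a_2\le b_2$. Write $G_i=[\underline{G}_i,\overline{G}_i]$ with real-valued endpoint functions $\underline{G}_i\le\overline{G}_i$. ''$gH$-continuously differentiable'' means that the endpoint functions are differentiable and the $gH$-gradient $\nabla_{gH}G_i(x)$ is continuous in $x$, where $\nabla_{gH}G_i(x)$ is the vector of intervals whose $j$-th component is $[\underline{\nabla_{gH}G_i}(x)_j,\overline{\nabla_{gH}G_i}(x)_j]$ with $$\underline{\nabla_{gH}G_i}(x)_j=\min\{\partial_j\underline{G}_i(x),\partial_j\overline{G}_i(x)\},\qquad \overline{\nabla_{gH}G_i}(x)_j=\max\{\partial_j\underline{G}_i(x),\partial_j\overline{G}_i(x)\};$$ continuity means that the maps $\underline{\nabla_{gH}G_i},\overline{\nabla_{gH}G_i}:\mathbb{R}^n\to\mathbb{R}^n$ are continuous. For $x,v\in\mathbb{R}^n$, with $|v|=(|v_1|,\dots,|v_n|)^\top$, $$\psi\circ\phi_x(v):=\max_{1\le i\le m}\Big[\tfrac12\big(\underline{\nabla_{gH}G_i}(x)+\overline{\nabla_{gH}G_i}(x)\big)^\top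 v+\tfrac12\big(\overline{\nabla_{gH}G_i}(x)-\underline{\nabla_{gH}G_i}(x)\big)^\top|v|\Big].$$ *)

(* Defs.v *)
From mathcomp Require Import all_boot all_order all_algebra.
From mathcomp Require Import all_classical all_reals all_analysis.

Set Implicit Arguments.
Unset Strict Implicit.
Unset Printing Implicit Defensive.

Import Order.TTheory GRing.Theory Num.Theory.
Import numFieldNormedType.Exports.

Local Open Scope ring_scope.
Local Open Scope classical_set_scope.

(* I(R): a closed bounded interval is given by its two endpoints. *)
Record citv (R : realType) := CItv {
  lo : R;
  hi : R;
  lo_le_hi : lo <= hi }.

Arguments lo {R} _.
Arguments hi {R} _.

Lemma min_le_max (R : realType) (a b : R) : Num.min a b <= Num.max a b.
Proof. by rewrite ge_min !le_max lexx. Qed.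

Definition pointI (R : realType) (a : R) : citv R := CItv (lexx a).

(* The interval [min{a, b}, max{a, b}]. *)
Definition hullI (R : realType) (a b : R) : citv R := CItv (min_le_max a b).

Definition addI (R : realType) (A B : citv R) : citv R :=
  CItv (lerD (lo_le_hi A) (lo_le_hi B)).

Definition scaleI (R : realType) (alpha : R) (A : citv R) : citv R :=
  hullI (alpha * lo A) (alpha * hi A).

Definition leI (R : realType) (A B : citv R) : Prop :=
  lo A <= lo B /\ hi A <= hi B.

Definition dot (R : realType) (n : nat) (u v : 'rV[R]_n) : R :=
  \sum_(j < n) u 0 j * v 0 j.

Definition absv (R : realType) (n : nat) (v : 'rV[R]_n) : 'rV[R]_n :=
  map_mx (fun t => `|t|) v.

Definition pderiv (R : realType) (n : nat) (f : 'rV[R]_n -> R) (j : 'I_n)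
  (x : 'rV[R]_n) : R := 'D_(delta_mx 0 j) f x.

Definition gH_gradient (R : realType) (n : nat) (F : 'rV[R]_n -> citv R)
    (x : 'rV[R]_n) : 'rV[citv R]_n :=
  \row_(j < n) hullI (pderiv (lo \o F) j x) (pderiv (hi \o F) j x).

Definition gH_gradient_lo (R : realType) (n : nat) (F : 'rV[R]_n -> citv R)
    (x : 'rV[R]_n) : 'rV[R]_n := map_mx lo (gH_gradient F x).

Definition gH_gradient_hi (R : realType) (n : nat) (F : 'rV[R]_n -> citv R)
    (x : 'rV[R]_n) : 'rV[R]_n := map_mx hi (gH_gradient F x).

Definition gH_continuously_differentiable (R : realType) (n : nat)
    (F : 'rV[R]_n -> citv R) : Prop :=
  [/\ forall x, differentiable (lo \o F) x,
      forall x, differentiable (hi \o F) x,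
      continuous (gH_gradient_lo F) &
      continuous (gH_gradient_hi F)].

(* The family G_1, ..., G_m is indexed by 'I_m.+1 so that the maximum is over
   a nonempty set; the default value of the big operator is one of its terms. *)
Definition psi_phi (R : realType) (m n : nat)
    (G : 'I_m.+1 -> 'rV[R]_n -> citv R) (x v : 'rV[R]_n) : R :=
  let term i :=
    2^-1 * dot (gH_gradient_lo (G i) x + gH_gradient_hi (G i) x) v
    + 2^-1 * dot (gH_gradient_hi (G i) x - gH_gradient_lo (G i) x) (absv v) in
  \big[Num.max/term ord0]_(i < m.+1) term i.

Definition sufficient_decrease (R : realType) (m n : nat)
    (G : 'I_m.+1 -> 'rV[R]_n -> citv R) (rho : R) (x d : 'rV[R]_n) (t : R) :
    Prop :=
  forall i : 'I_m.+1,
    leI (G i (x + t *: d))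
        (addI (G i x) (scaleI (psi_phi G x d) (pointI (rho * t)))).

Definition standard_wolfe (R : realType) (m n : nat)
    (G : 'I_m.+1 -> 'rV[R]_n -> citv R) (rho sigma : R) (x d : 'rV[R]_n)
    (t : R) : Prop :=
  sufficient_decrease G rho x d t /\
  psi_phi G (x + t *: d) d >= sigma * psi_phi G x d.

Definition strong_wolfe (R : realType) (m n : nat)
    (G : 'I_m.+1 -> 'rV[R]_n -> citv R) (rho sigma : R) (x d : 'rV[R]_n)
    (t : R) : Prop :=
  sufficient_decrease G rho x d t /\
  `|psi_phi G (x + t *: d) d| <= sigma * `|psi_phi G x d|.

(* Main.v *)
Require Import Defs.
From mathcomp Require Import all_boot all_order all_algebra.
From mathcomp Require Import all_classical all_reals all_analysis.
From mathcomp Require Import ring lra.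

Import Order.TTheory GRing.Theory Num.Theory.
Import numFieldNormedType.Exports.

Local Open Scope ring_scope.
Local Open Scope classical_set_scope.

(** Write [Psi t] for [psi_phi G (x + t *: d) d] and [c := Psi 0 < 0].  For each
    of the endpoint functions [f] of the [G i], the derivative of
    [t |-> f (x + t *: d)] is at most [Psi t] ([dot_pderiv_le_psi_phi]): the value
    [psi_phi G y v] is the largest of the sums of [max (p_j v_j, q_j v_j)] over
    [j], where [p] and [q] are the gradients of the two endpoints of a [G i].

    If [Psi] stayed below [rho * c] on the whole half-line, integrating this
    bound would make every [f (x + t *: d)] fall below the line
    [f x + rho * c * t] of negative slope ([endpoint_descent]), hence tend to
    -oo, against [G_bounded] ([exists_psi_phi_ge]).  So [Psi], which is
    continuous ([psi_phi_continuous]), must climb from [c < rho * c] to the level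
    [rho * c]; let [b > 0] be the first time at which it does ([first_passage]).

    All the conditions hold just to the left of [b].  Before [b] one has
    [Psi < rho * c], so the same integration gives the sufficient decrease for
    every endpoint at once.  Close to [b], continuity gives
    [sigma * c < Psi] because [sigma * c < rho * c <= Psi b]; and since
    [Psi < rho * c < 0] there, this lower bound is both the standard and the
    strong curvature condition. *)

(** * Continuity of the directional bound *)

(** The starting value of the iterated maximum is a function too, because the
    maximum of a nonempty family is encoded with one of its own terms as the
    starting value. *)
Lemma continuous_bigmax {R : realType} {T : topologicalType} {I : Type}
    (r : seq I) (g : T -> R) (F : I -> T -> R) :
  continuous g -> (forall i, continuous (F i)) ->
  continuous (fun y => \big[Num.max/g y]_(i <- r) F i y).
Proof.
move=> cg cF; elim: r => [|i r IHr].
  by under eq_fun do rewrite big_nil.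
under eq_fun do rewrite big_cons.
by move=> y; apply: continuous_max; [exact: cF|exact: IHr].
Qed.

Lemma continuous_dotl {R : realType} {n : nat} {T : topologicalType}
    (F : T -> 'rV[R]_n) (v : 'rV[R]_n) :
  continuous F -> continuous (fun y => dot (F y) v).
Proof.
move=> cF; apply: continuous_big => [|j _ y]; first exact: add_continuous.
apply: (@continuousM R T (fun y => F y 0 j) (cst (v 0 j))); last exact: cst_continuous.
by apply: (@continuous_comp _ _ _ F (fun M => M 0 j)); [exact: cF|exact: coord_continuous].
Qed.

Lemma psi_phi_continuous {R : realType} {m n : nat}
    (G : 'I_m.+1 -> 'rV[R]_n -> citv R) (v : 'rV[R]_n) :
  (forall i, gH_continuously_differentiable (G i)) ->
  continuous (fun y => psi_phi G y v).
Proof.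
move=> G_diff; rewrite /psi_phi.
have cterm i : continuous (fun y =>
    2^-1 * dot (gH_gradient_lo (G i) y + gH_gradient_hi (G i) y) v
    + 2^-1 * dot (gH_gradient_hi (G i) y - gH_gradient_lo (G i) y) (absv v)).
  have [_ _ clo chi] := G_diff i.
  have clohi : continuous (gH_gradient_lo (G i) \+ gH_gradient_hi (G i)).
    by move=> y; exact: (continuousD (clo y) (chi y)).
  have chilo : continuous (gH_gradient_hi (G i) \- gH_gradient_lo (G i)).
    by move=> y; exact: (continuousB (chi y) (clo y)).
  have ccst := @cst_continuous _ R (2^-1 : R).
  move=> y; exact: (continuousD
    (continuousM (ccst _ y) (continuous_dotl _ v clohi y))
    (continuousM (ccst _ y) (continuous_dotl _ (absv v) chilo y))).
by apply: continuous_bigmax.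
Qed.

(** * The directional bound dominates the derivatives of the endpoints *)

(** The common right-hand side is [max (p * w) (q * w)], since [hullI p q] has
    midpoint [2^-1 * (p + q)] and half-width [2^-1 * `|p - q|]. *)
Lemma ler_hullI_dir {R : realType} (p q w : R) :
  p * w <= 2^-1 * ((lo (hullI p q) + hi (hullI p q)) * w)
           + 2^-1 * ((hi (hullI p q) - lo (hullI p q)) * `|w|) /\
  q * w <= 2^-1 * ((lo (hullI p q) + hi (hullI p q)) * w)
           + 2^-1 * ((hi (hullI p q) - lo (hullI p q)) * `|w|).
Proof.
rewrite /=; have [w0|w0] := leP 0 w; [rewrite ger0_norm//|rewrite ltr0_norm//];
  case: (leP p q) => pq; split; nra.
Qed.

Lemma dot_pderiv_le_psi_phi {R : realType} {m n : nat}
    (G : 'I_m.+1 -> 'rV[R]_n -> citv R) (y v : 'rV[R]_n) (i : 'I_m.+1) :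
  \sum_j pderiv (lo \o G i) j y * v 0 j <= psi_phi G y v /\
  \sum_j pderiv (hi \o G i) j y * v 0 j <= psi_phi G y v.
Proof.
pose term (k : 'I_m.+1) : R :=
  2^-1 * dot (gH_gradient_lo (G k) y + gH_gradient_hi (G k) y) v
  + 2^-1 * dot (gH_gradient_hi (G k) y - gH_gradient_lo (G k) y) (absv v).
have le_term : term i <= psi_phi G y v by exact: le_bigmax.
suff : \sum_j pderiv (lo \o G i) j y * v 0 j <= term i /\
       \sum_j pderiv (hi \o G i) j y * v 0 j <= term i.
  by move=> [lo_le hi_le]; split; apply: le_trans le_term.
rewrite /term /dot !mulr_sumr -big_split /=.
by split; apply: ler_sum => j _; rewrite !mxE;
  have [] := ler_hullI_dir (pderiv (lo \o G i) j y) (pderiv (hi \o G i) j y) (v 0 j).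
Qed.

Lemma differentiable_dirE {R : realType} {n : nat} (f : 'rV[R]_n -> R)
    (y v : 'rV[R]_n) :
  differentiable f y -> 'd f y v = \sum_j pderiv f j y * v 0 j.
Proof.
move=> df; rewrite [in LHS](row_sum_delta v) linear_sum.
by apply: eq_bigr => j _; rewrite linearZ /pderiv deriveE// mulrC.
Qed.

Lemma is_derive_line {R : realType} {n : nat} (f : 'rV[R]_n -> R)
    (x d : 'rV[R]_n) (t : R) :
  differentiable f (x + t *: d) ->
  is_derive t 1 (fun s => f (x + s *: d)) ('d f (x + t *: d) d).
Proof.
move=> df.
have dline : is_diff t (fun s : R => x + s *: d) ( *:%R ^~ d).
  by apply: is_diff_eq; rewrite add0r.
have dcomp := @differentiable_comp _ _ _ _ (fun s : R => x + s *: d) f t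
  (@ex_diff _ _ _ _ _ _ _ dline) df.
apply: DeriveDef; first exact/derivable1_diffP.
rewrite deriveE// (@diff_comp _ _ _ _ (fun s : R => x + s *: d) f t)//=.
by rewrite (@diff_val _ _ _ _ _ _ _ dline) scale1r.
Qed.

(** The mean value theorem on [[0, t]] turns the pointwise bound on the slope
    into a bound by the line of slope [u]. *)
Lemma endpoint_descent {R : realType} {n : nat} (f : 'rV[R]_n -> R)
    (x d : 'rV[R]_n) (u t : R) :
  (forall y, differentiable f y) -> 0 < t ->
  (forall s, 0 < s < t -> \sum_j pderiv f j (x + s *: d) * d 0 j <= u) ->
  f (x + t *: d) <= f x + u * t.
Proof.
move=> df t0 slope_le.
have dline s := is_derive_line _ _ _ s (df (x + s *: d)).
have cline : {within `[0, t], continuous (fun s => f (x + s *: d))}.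
  by apply: derivable_within_continuous => s _; have /@ex_derive := dline s.
have [s] := MVT t0 (fun s _ => dline s) cline.
rewrite in_itv /= => st; rewrite scale0r addr0 subr0 => eq_incr.
rewrite -lerBlDl eq_incr ler_pM2r// differentiable_dirE//.
exact: slope_le.
Qed.

(** * First passage of a continuous function *)

(** Take [b] to be the infimum of the times [t >= 0] with [u <= h t].  By
    continuity it is attained, so [w < u <= h b] persists near [b], while no
    earlier time reaches [u]; and [h 0 < u] makes [b] positive. *)
Lemma first_passage {R : realType} (h : R -> R) (u w s : R) :
  continuous h -> h 0 < u -> w < u -> 0 < s -> u <= h s ->
  exists a b : R, [/\ 0 <= a, a < b,
    forall t, 0 < t < b -> h t < u & forall t, a < t < b -> w < h t].
Proof.
move=> ch h0u wu s0 us.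
pose E : set R := [set t | 0 <= t /\ u <= h t].
have E_inf : has_inf E.
  by split; [exists s; split=> //; exact: ltW|exists 0 => t []].
pose b := inf E.
have b_ge0 : 0 <= b by apply: lb_le_inf; [case: E_inf|move=> t []].
have hb : u <= h b.
  rewrite leNgt; apply/negP => hbu.
  have : \forall t \near b, h t < u by exact: cvgr_lt (ch b) _ hbu.
  move=> /nbhs_ballP[e /= e0 he].
  have [t [t0 ut] tbe] := inf_adherent e0 E_inf.
  have bt : b <= t by apply: ge_inf => //; case: E_inf.
  suff : h t < u by rewrite ltNge ut.
  by apply: he; rewrite /ball /= distrC ger0_norm ?subr_ge0// ltrBlDl.
have b_gt0 : 0 < b.
  by rewrite lt_neqAle b_ge0 andbT; apply/eqP => b0; move: hb; rewrite -b0 leNgt h0u.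
have : \forall t \near b, w < h t.
  by exact: cvgr_gt (ch b) _ (lt_le_trans wu hb).
move=> /nbhs_ballP[e /= e0 he].
exists (Num.max 0 (b - e)), b; split.
- by rewrite le_max lexx.
- by rewrite gt_max b_gt0/= gtrBl.
- move=> t /andP[t0 tb]; rewrite ltNge; apply/negP => ut.
  have : b <= t by apply: ge_inf; [case: E_inf|split=> //; exact: ltW].
  by rewrite leNgt tb.
- move=> t /andP[]; rewrite gt_max => /andP[_ bet] tb.
  by apply: he; rewrite /ball /= ger0_norm ?subr_ge0 ?(ltW tb)// ltrBlDl -ltrBlDr.
Qed.

(** * Wolfe steps *)

Lemma sufficient_decrease_of_psi_phi_le {R : realType} {m n : nat}
    (G : 'I_m.+1 -> 'rV[R]_n -> citv R) (rho : R) (x d : 'rV[R]_n) (t : R) :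
  (forall i, gH_continuously_differentiable (G i)) -> 0 < t ->
  (forall s, 0 < s < t -> psi_phi G (x + s *: d) d <= rho * psi_phi G x d) ->
  sufficient_decrease G rho x d t.
Proof.
move=> G_diff t0 psi_le i; have [dlo dhi _ _] := G_diff i.
rewrite /leI /= minxx maxxx.
have -> : psi_phi G x d * (rho * t) = rho * psi_phi G x d * t by ring.
split.
- apply: (@endpoint_descent R n (lo \o G i)) => // s st.
  by apply: le_trans (psi_le s st); have [] := dot_pderiv_le_psi_phi G (x + s *: d) d i.
- apply: (@endpoint_descent R n (hi \o G i)) => // s st.
  by apply: le_trans (psi_le s st); have [] := dot_pderiv_le_psi_phi G (x + s *: d) d i.
Qed.

(** Otherwise the sufficient decrease would hold at every positive step, so the
    lower endpoint of [G ord0] would be unbounded below along the ray. *)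
Lemma exists_psi_phi_ge {R : realType} {m n : nat}
    (G : 'I_m.+1 -> 'rV[R]_n -> citv R) (rho : R) (x d : 'rV[R]_n) :
  (forall i, gH_continuously_differentiable (G i)) ->
  0 < rho -> psi_phi G x d < 0 ->
  (exists A : citv R, forall t : R, 0 < t -> leI A (G ord0 (x + t *: d))) ->
  exists2 s : R, 0 < s & rho * psi_phi G x d <= psi_phi G (x + s *: d) d.
Proof.
move=> G_diff rho0 c0 [A leA]; apply: contrapT => no_s.
have psi_lt s : 0 < s -> psi_phi G (x + s *: d) d <= rho * psi_phi G x d.
  by move=> s0; rewrite leNgt; apply/negP => /ltW us; apply: no_s; exists s.
have [le_loA _] := leA 1 ltr01.
set c := psi_phi G x d in c0 psi_lt.
have rc0 : rho * c < 0 by rewrite pmulr_rlt0.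
(* The time at which the line of slope [rho * c] has dropped one unit below
   [lo A]; the absolute value keeps it positive. *)
pose t := (`|lo (G ord0 x) - lo A| + 1) / - (rho * c).
have t0 : 0 < t by rewrite divr_gt0 ?oppr_gt0// ltr_wpDl.
have [|lo_le _] := @sufficient_decrease_of_psi_phi_le R m n G rho x d t G_diff t0 _ ord0.
  by move=> s /andP[s0 _]; exact: psi_lt.
have [loA _] := leA t t0.
move: (le_trans loA lo_le); rewrite /= minxx -/c.
have -> : c * (rho * t) = - (`|lo (G ord0 x) - lo A| + 1).
  rewrite -(@divfK _ (- (rho * c)) _ (`|lo (G ord0 x) - lo A| + 1)) -/t; first ring.
  by rewrite oppr_eq0 lt_eqF.
have := ler_norm (lo (G ord0 x) - lo A).
lra.
Qed.

Theorem proposition3p1 (R : realType) (m n : nat) (rho sigma : R)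
    (G : 'I_m.+1 -> 'rV[R]_n -> citv R) (x d : 'rV[R]_n)
    (rho_gt0 : 0 < rho) (rho_lt_sigma : rho < sigma) (sigma_lt1 : sigma < 1)
    (G_diff : forall i, gH_continuously_differentiable (G i))
    (d_descent : psi_phi G x d < 0)
    (G_bounded : forall i, exists A : citv R,
        forall t : R, 0 < t -> leI A (G i (x + t *: d))) :
  exists a b : R, [/\ 0 <= a, a < b &
    forall t : R, a < t -> t < b ->
      standard_wolfe G rho sigma x d t /\ strong_wolfe G rho sigma x d t].
Proof.
have [s s0 psi_s] :=
  exists_psi_phi_ge _ _ _ _ G_diff rho_gt0 d_descent (G_bounded ord0).
have cPsi : continuous (fun t : R => psi_phi G (x + t *: d) d).
  move=> t; apply: (@continuous_comp _ _ _ (fun t : R => x + t *: d)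
    (fun y => psi_phi G y d)); last exact: psi_phi_continuous.
  by apply: cvgD; [exact: cvg_cst|exact: scalel_continuous].
have c_lt : psi_phi G x d < rho * psi_phi G x d.
  by rewrite ltr_nMl// (lt_trans rho_lt_sigma).
have sc_lt : sigma * psi_phi G x d < rho * psi_phi G x d by rewrite ltr_nM2r.
have [|a [b [a0 ab psi_lt lt_psi]]] :=
  first_passage _ _ _ _ cPsi _ sc_lt s0 psi_s.
  by rewrite scale0r addr0.
exists a, b; split; [exact: a0|exact: ab|move=> t at_ tb].
have t0 : 0 < t by exact: le_lt_trans at_.
have decrease : sufficient_decrease G rho x d t.
  apply: (sufficient_decrease_of_psi_phi_le _ _ _ _ _ G_diff t0) => r /andP[r0 rt].
  by apply/ltW/psi_lt; rewrite r0 (lt_trans rt tb).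
have psi_gt : sigma * psi_phi G x d < psi_phi G (x + t *: d) d.
  by apply: lt_psi; rewrite at_ tb.
have psi_t0 : psi_phi G (x + t *: d) d < 0.
  by apply: lt_trans (psi_lt t _) _; rewrite ?t0 ?tb// pmulr_rlt0.
split; split; [exact: decrease|exact: ltW|exact: decrease|].
rewrite ler_norml (ltr0_norm d_descent) mulrN opprK; apply/andP; split.
  exact: ltW psi_gt.
apply: le_trans (ltW psi_t0) _; rewrite oppr_ge0 pmulr_rle0; first exact: ltW d_descent.
exact: lt_trans rho_lt_sigma.
Qed.
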